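(* Let $m\ge 1$ be an integer and let $c$ be the chip configuration on the one-dimensional grid $\mathbb{Z}$ having $2$ chips at site $0$, $1$ chip at each of the sites $-(m-1),\dots,-1$ and $1,\dots,m-1$, and no chips elsewhere. Then the configuration poset of $c$ is a distributive lattice.
   Context: Chip-firing on $\mathbb{Z}$ (sites $k$ and $k+1$ are adjacent for every $k$): a chip configuration is a function $\mathbb{Z}\to\mathbb{N}=\{0,1,2,\dots\}$; a site with at least $2$ chips can fire, sending one chip to each of its two neighbors. The configuration poset of $c$ has as elements all configurations reachable from $c$ by finite (possibly empty) sequences of legal firing moves, with $c_1\ge c_2$ if and only if $c_2$ can be reached from $c_1$ by some (possibly empty) sequence of firing moves. *)

(* Defs.v *)
From Stdlib Require Import Relation_Operators.
From mathcomp Require Import all_boot all_order all_algebra.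
Set Implicit Arguments.
Unset Strict Implicit.
Unset Printing Implicit Defensive.
Import Order.TTheory GRing.Theory.
Local Open Scope ring_scope.

Definition config := int -> nat.

Definition fire (k : int) (c : config) : config := fun i =>
  if i == k then (c i - 2)%N
  else if (i == k - 1) || (i == k + 1) then (c i).+1
  else c i.

Definition fires_to (c c' : config) : Prop :=
  exists k : int, (2 <= c k)%N /\ c' = fire k c.

Definition reachable : config -> config -> Prop :=
  clos_refl_trans config fires_to.

Definition config_poset (c : config) : Type := {x : config | reachable c x}.

(* Firing goes down: the initial configuration is the greatest element. *)
Definition config_le (c : config) (x y : config_poset c) : Prop :=
  reachable (proj1_sig y) (proj1_sig x).

(* [distrLatticeType] is a bundled structure with a boolean order, so a type
   with a Prop-valued relation is declared to be a distributive lattice when it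
   is order-isomorphic to one; this entails that [le] is a partial order. *)
Definition is_distr_lattice (T : Type) (le : T -> T -> Prop) : Prop :=
  exists (d : Order.disp_t) (L : distrLatticeType d) (f : L -> T),
    bijective f /\ (forall x y : L, (x <= y)%O <-> le (f x) (f y)).

Definition initial_config (m : nat) : config := fun i =>
  if i == 0 then 2%N else if (`|i| < m)%N then 1%N else 0%N.

(* Main.v *)
Require Import Defs.
From mathcomp Require Import all_boot all_order all_algebra.
From HB Require Import structures.
From Stdlib Require Import Relation_Operators.
From mathcomp Require Import boolp zify.

Set Implicit Arguments.
Unset Strict Implicit.
Unset Printing Implicit Defensive.
Import Order.TTheory GRing.Theory.
Local Open Scope ring_scope.

(** A configuration reached from the initial one is encoded by its odometer:
    the function [u] that counts how often each site has fired.  Firing adds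
    the discrete Laplacian of the odometer to the configuration, so [u]
    determines the configuration ([fired]), and conversely, since an odometer
    has finite support and the Laplacian is injective on functions of finite
    support ([fired_inj]).

    The odometers that occur are exactly the staircases: functions vanishing
    at distance at least [m] from the origin that, at every step away from the
    origin, drop by 0 or 1.  Indeed, for a staircase [u], site [k] can fire if
    and only if increasing [u k] by one leaves a staircase
    ([staircase_add_firing]): at [0 < k < m] both say that [u (k - 1) = u k + 1]
    and [u (k + 1) = u k], and at the origin both say that the three values
    [u (-1)], [u 0], [u 1] agree.

    Moreover, between two staircases [u <= v] one can always get from [u] to
    [v] by legal firings ([reachable_fired_le]), because among the sites that
    still have to fire, one with the lexicographically least [(u k, |k|)] is
    able to ([exists_firing]).  Hence reachability is the pointwise order on
    staircases.  Bounds of the form [u i <= u j] and [u i <= u j + 1] survive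
    pointwise minima and maxima, so the staircases form a sublattice of a
    power of the distributive lattice of natural numbers; the configuration
    poset is the dual of that sublattice, since firing goes down. *)

(** * Distributive lattices up to isomorphism *)

Lemma sig_eq (T : Type) (P : T -> Prop) (x y : {z | P z}) :
  sval x = sval y -> x = y.
Proof. by case: x y => [x hx] [y hy] /= e; exact: eq_exist. Qed.

Lemma is_distr_lattice_iso (S T : Type) (leS : S -> S -> Prop)
    (leT : T -> T -> Prop) (f : S -> T) :
  bijective f -> (forall x y, leS x y <-> leT (f x) (f y)) ->
  is_distr_lattice leS -> is_distr_lattice leT.
Proof.
move=> bij_f f_mono [d [L [g [bij_g g_mono]]]].
exists d, L, (f \o g); split; first exact: bij_comp.
by move=> x y; rewrite g_mono f_mono.
Qed.

Lemma is_distr_lattice_dual (T : Type) (le : T -> T -> Prop) :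
  is_distr_lattice le -> is_distr_lattice (fun x y => le y x).
Proof.
move=> [d [L [f [bij_f f_mono]]]].
by exists (Order.dual_display d), (L^d)%O, f; split=> // x y; rewrite -f_mono.
Qed.

(** The identities defining a distributive lattice hold in a power of [D]
    coordinate by coordinate, hence in any part of it closed under the
    pointwise operations. *)
Lemma is_distr_lattice_pointwise (I : Type) (d : Order.disp_t)
    (D : distrLatticeType d) (P : (I -> D) -> Prop)
    (P_meet : forall u v, P u -> P v -> P (fun i => u i `&` v i)%O)
    (P_join : forall u v, P u -> P v -> P (fun i => u i `|` v i)%O) :
  is_distr_lattice (fun x y : {u | P u} => forall i, (sval x i <= sval y i)%O).
Proof.
pose T : choiceType :=
  HB.pack {u | P u} (gen_eqMixin {u | P u}) (gen_choiceMixin {u | P u}).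
pose meet (x y : T) : T := exist P _ (P_meet _ _ (proj2_sig x) (proj2_sig y)).
pose join (x y : T) : T := exist P _ (P_join _ _ (proj2_sig x) (proj2_sig y)).
have extP (x y : T) : (forall i, sval x i = sval y i) -> x = y.
  by move=> e; apply: sig_eq; apply: funext.
(* The order is declared as [meet x y == x], hence these trivial identities. *)
have le_def (x y : T) : (meet x y == x) = (meet x y == x) by [].
have lt_def (x y : T) :
  (y != x) && (meet x y == x) = (y != x) && (meet x y == x) by [].
pose L : distrLatticeType d :=
  HB.pack (Choice.sort T) (Order.isMeetJoinDistrLattice.Build
    d (Choice.sort T) le_def lt_def
    (fun x y => extP (meet x y) (meet y x) (fun=> meetC _ _))
    (fun x y => extP (join x y) (join y x) (fun=> joinC _ _))
    (fun x y z => extP (meet x (meet y z)) (meet (meet x y) z)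
                    (fun=> meetA _ _ _))
    (fun x y z => extP (join x (join y z)) (join (join x y) z)
                    (fun=> joinA _ _ _))
    (fun y x => extP (meet x (join x y)) x (fun=> joinKI _ _))
    (fun y x => extP (join x (meet x y)) x (fun=> meetKU _ _))
    (fun x y z => extP (meet (join x y) z) (join (meet x z) (meet y z))
                    (fun=> meetUl _ _ _))
    (fun x => extP (meet x x) x (fun=> meetxx _))).
exists d, L, (fun x : L => x : {u | P u}).
split; first by exists id.
move=> x y; split=> [/eqP e i | le_xy].
  by rewrite -[in X in (X <= _)%O]e /= leIr.
by apply/eqP; apply: (extP (meet x y) x) => i /=; apply/meet_idPl.
Qed.

(** * Staircases and the configurations they produce *)

(** The odometers of the process.  The second and third clauses are separate
    because the outward neighbour of a site depends on the side of the origin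
    on which it lies; the origin obeys both. *)
Definition staircase (m : nat) (u : int -> nat) : Prop :=
  [/\ forall i : int, (m <= `|i|)%N -> u i = 0%N,
      forall i : int, 0 <= i -> (u (i + 1)%R <= u i <= (u (i + 1)%R).+1)%N
    & forall i : int, i <= 0 -> (u (i - 1)%R <= u i <= (u (i - 1)%R).+1)%N].

Definition add_firing (k : int) (u : int -> nat) : int -> nat :=
  fun i => (u i + (i == k))%N.

(** The initial configuration plus the Laplacian of [u].  For a staircase the
    truncated subtraction is exact, by [fired_balance]. *)
Definition fired (m : nat) (u : int -> nat) : config :=
  fun i => (initial_config m i + u (i - 1)%R + u (i + 1)%R - 2 * u i)%N.

Lemma staircase_min m u v : staircase m u -> staircase m v ->
  staircase m (fun i => minn (u i) (v i)).
Proof.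
move=> [u0 uR uL] [v0 vR vL]; split=> i hi.
- by rewrite u0 // v0.
- by have := uR i hi; have := vR i hi; lia.
- by have := uL i hi; have := vL i hi; lia.
Qed.

Lemma staircase_max m u v : staircase m u -> staircase m v ->
  staircase m (fun i => maxn (u i) (v i)).
Proof.
move=> [u0 uR uL] [v0 vR vL]; split=> i hi.
- by rewrite u0 // v0.
- by have := uR i hi; have := vR i hi; lia.
- by have := uL i hi; have := vL i hi; lia.
Qed.

(** All constraints linking the value at [i] to its neighbours, in a form that
    linear arithmetic can use at one site. *)
Lemma staircase_at m u (i : int) : staircase m u ->
  [/\ (m <= `|i|)%N -> u i = 0%N,
      0 <= i -> (u (i + 1)%R <= u i <= (u (i + 1)%R).+1)%N,
      i <= 0 -> (u (i - 1)%R <= u i <= (u (i - 1)%R).+1)%N,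
      0 < i -> (u i <= u (i - 1)%R <= (u i).+1)%N
    & i < 0 -> (u i <= u (i + 1)%R <= (u i).+1)%N].
Proof.
move=> [u0 uR uL]; split; [exact: u0 | exact: uR | exact: uL | |] => hi.
  by have := uR (i - 1); rewrite subrK; apply; lia.
by have := uL (i + 1); rewrite addrK; apply; lia.
Qed.

(** No site ever owes chips.  Only sites closer than [m] fire.  Off the origin,
    the inward neighbour has fired at least [u i] times, the outward one at
    least [u i - 1] times, and one chip was there initially; at the origin both neighbours may lag by one, but two
    chips were there. *)
Lemma fired_balance m u i : (0 < m)%N -> staircase m u ->
  (2 * u i <= initial_config m i + u (i - 1)%R + u (i + 1)%R)%N.
Proof.
move=> m_gt0 /(staircase_at i)[u0 uR uL uR' uL'].
rewrite /initial_config.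
have [m_le|i_lt] := leqP m `|i|; first by rewrite u0.
by case: eqP => i0; lia.
Qed.

(** Legality of a firing depends only on the shape of the odometer.  One
    direction is the nonnegativity [fired_balance] of the resulting
    configuration; for the other, two chips at [k] force the values at the
    neighbours of [k] to be those that leave room for one more firing. *)
Lemma staircase_add_firing m u k : (0 < m)%N -> staircase m u ->
  staircase m (add_firing k u) <-> (2 <= fired m u k)%N.
Proof.
move=> m_gt0 su; split=> [su'|].
  have := fired_balance k m_gt0 su'; rewrite /fired /add_firing eqxx.
  have -> : (k - 1 == k) = false by lia.
  have -> : (k + 1 == k) = false by lia.
  lia.
have [u0 uR uL uR' uL'] := staircase_at k su.
rewrite /fired /initial_config => two_le.
(* Where nothing was placed initially, [u k = 0], the outward neighbour never
   fired and the inward one fired at most once: at most one chip is there. *)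
have k_lt : (`|k| < m)%N.
  have [m_le|//] := leqP m `|k|.
  have := u0 m_le; move: two_le; rewrite [(`|k| < m)%N]ltnNge m_le /=.
  by case: eqP => k0; lia.
move: two_le; rewrite k_lt => two_le.
rewrite /add_firing; split=> i hi.
- case: (i =P k) => [|_]; first lia.
  by rewrite addn0; have [->] := su.
- have [_ /(_ hi) ui _ _ _] := staircase_at i su.
  have [ik|ik] := eqVneq i k; first by subst i; case: eqP two_le; lia.
  have [ik'|ik'] := eqVneq (i + 1) k; last by rewrite !addn0.
  have ei : i = k - 1 by lia.
  subst i; move: ui; rewrite subrK; case: eqP two_le; lia.
- have [_ _ /(_ hi) ui _ _] := staircase_at i su.
  have [ik|ik] := eqVneq i k; first by subst i; case: eqP two_le; lia.
  have [ik'|ik'] := eqVneq (i - 1) k; last by rewrite !addn0.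
  have ei : i = k + 1 by lia.
  subst i; move: ui; rewrite addrK; case: eqP two_le; lia.
Qed.

Lemma fire_fired m u k : (0 < m)%N -> staircase m u -> (2 <= fired m u k)%N ->
  fire k (fired m u) = fired m (add_firing k u).
Proof.
move=> m_gt0 su; rewrite /fired => two_le; apply: funext => i.
have bal := fired_balance i m_gt0 su.
rewrite /fire /fired /add_firing.
have [ik|ik] := eqVneq i k.
  subst i.
  have -> : (k - 1 == k) = false by lia.
  have -> : (k + 1 == k) = false by lia.
  lia.
have -> : (i - 1 == k) = (i == k + 1) by lia.
have -> : (i + 1 == k) = (i == k - 1) by lia.
have [e1|_] := eqVneq i (k - 1); have [e2|_] := eqVneq i (k + 1);
  by move=> /=; lia.
Qed.

(** Both odometers vanish at [m] and beyond; equality of the Laplacians at a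
    site expresses the value to its left by the values at the site and to its
    right, so equality propagates leftwards from [m]. *)
Lemma fired_inj m u v : (0 < m)%N -> staircase m u -> staircase m v ->
  fired m u = fired m v -> u = v.
Proof.
move=> m_gt0 su sv e.
have eq_at n : u (m%:Z - n%:Z) = v (m%:Z - n%:Z) /\
               u (m%:Z - n%:Z + 1) = v (m%:Z - n%:Z + 1).
  elim: n => [|n [IH1 IH2]].
    have [u0 _ _] := su; have [v0 _ _] := sv.
    by rewrite !u0 ?v0 //; lia.
  have -> : m%:Z - n.+1%:Z = m%:Z - n%:Z - 1 by lia.
  rewrite subrK; split=> //.
  have := congr1 (fun c => c (m%:Z - n%:Z)) e; rewrite /fired.
  have := fired_balance (m%:Z - n%:Z) m_gt0 su.
  have := fired_balance (m%:Z - n%:Z) m_gt0 sv.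
  lia.
apply: funext => i; have [i_ge|i_lt] := leP m%:Z i.
  have [u0 _ _] := su; have [v0 _ _] := sv.
  by rewrite u0 ?v0 //; lia.
have [+ _] := eq_at `|m%:Z - i|%N.
by have -> : m%:Z - `|m%:Z - i|%N%:Z = i by lia.
Qed.

(** * Reachability is the pointwise order on odometers *)

(** If a site [k] that has to fire cannot, then either its outward neighbour has
    fired less often than [k], or its inward neighbour only as often as [k]
    (for the origin, a neighbour has fired less often).  As [v] is a staircase
    too, that neighbour also has to fire, and it precedes [k] in the
    lexicographic order of [(u k, |k|)]. *)
Lemma exists_firing m u v k : (0 < m)%N -> staircase m u -> staircase m v ->
  (u k < v k)%N ->
  exists2 j, (u j < v j)%N & (2 <= fired m u j)%N.
Proof.
move=> m_gt0 su sv.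
(* On [|k| < m] this number orders sites lexicographically by [(u k, |k|)]. *)
have [n] := ubnP (u k * m + `|k|)%N; elim: n k => // n IHn k k_le uv_k.
have [u0 uR uL uR' uL'] := staircase_at k su.
have [v0 vR vL vR' vL'] := staircase_at k sv.
have k_lt : (`|k| < m)%N by have [/v0|] := leqP m `|k|; lia.
have [two_le|lt_two] := leqP 2 (fired m u k); first by exists k.
have step (j : int) : (u j < v j)%N -> (`|j| < m)%N ->
    (u j < u k)%N \/ (u j = u k /\ (`|j| < `|k|)%N) ->
    exists2 j, (u j < v j)%N & (2 <= fired m u j)%N.
  by move=> uv_j j_lt lt_jk; apply: IHn uv_j; nia.
have lt_m (j : int) : (u j < v j)%N -> (`|j| < m)%N.
  by move=> uv_j; have [v0' _ _] := sv; have [/v0'|//] := leqP m `|j|; lia.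
have [uv_l|uv_l] := boolP ((u (k - 1)%R < v (k - 1)%R) &&
    ((u (k - 1)%R < u k) || (u (k - 1)%R == u k) && (`|(k - 1)%R| < `|k|)))%N.
  by apply: (step (k - 1)); [lia | apply: lt_m; lia | lia].
have [uv_r|uv_r] := boolP ((u (k + 1)%R < v (k + 1)%R) &&
    ((u (k + 1)%R < u k) || (u (k + 1)%R == u k) && (`|(k + 1)%R| < `|k|)))%N.
  by apply: (step (k + 1)); [lia | apply: lt_m; lia | lia].
exfalso; move: lt_two; rewrite /fired /initial_config k_lt.
by case: eqP => [k0|k0]; lia.
Qed.

(** Induction on the number of firings still missing: some missing one is legal
    by [exists_firing], and performing it keeps the odometer a staircase below
    [v]. *)
Lemma reachable_fired_le m u v : (0 < m)%N -> staircase m u ->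
  staircase m v -> (forall i, (u i <= v i)%N) ->
  reachable (fired m u) (fired m v).
Proof.
move=> m_gt0 + sv.
pose deficit (w : int -> nat) :=
  (\sum_(i < (2 * m).+1) (v (i%:Z - m%:Z)%R - w (i%:Z - m%:Z)%R))%N.
have [n] := ubnP (deficit u); elim: n u => // n IHn u lt_n su le_uv.
have [[k uv_k]|/forallNP no_gap] := pselect (exists k, (u k < v k)%N);
  last first.
  have -> : u = v; last exact: rt_refl.
  by apply: funext => i; have := no_gap i; have := le_uv i; lia.
have {k uv_k} [k uv_k two_le] := exists_firing m_gt0 su sv uv_k.
apply: (rt_trans _ _ _ (fired m (add_firing k u))).
  by apply: rt_step; exists k; rewrite fire_fired.
apply: IHn; last 2 first.
- exact/staircase_add_firing.
- by move=> i; rewrite /add_firing; case: eqP (le_uv i) => [->|]; lia.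
move: lt_n; rewrite ltnS; apply: leq_trans; rewrite /deficit.
have k_lt : (`|k| < m)%N.
  by have [v0 _ _] := sv; have [/v0|//] := leqP m `|k|; lia.
have pos_lt : (`|(k + m%:Z)%R| < (2 * m).+1)%N by lia.
pose p := Ordinal pos_lt.
have ep : p%:Z - m%:Z = k by rewrite /p /=; lia.
rewrite (bigD1 p) //= [X in (_ < X)%N](bigD1 p) //= ep.
rewrite -addSn leq_add //; first by rewrite /add_firing eqxx; lia.
by apply: leq_sum => i _; rewrite /add_firing; lia.
Qed.

Lemma reachable_fired m u x : (0 < m)%N -> staircase m u ->
  reachable (fired m u) x ->
  exists v, [/\ staircase m v, forall i, (u i <= v i)%N & x = fired m v].
Proof.
move=> m_gt0 su; move: {-1}(fired m u) (erefl (fired m u)) => y ey rxy.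
elim: rxy u su ey => {x y}
  [x y [k [two_le ->]]|x|x y z _ IHxy _ IHyz] u su ey.
- rewrite -ey in two_le *; exists (add_firing k u); split.
  + exact/staircase_add_firing.
  + by move=> i; rewrite leq_addr.
  + exact: fire_fired.
- by exists u.
- have [v [sv le_uv ev]] := IHxy u su ey.
  have [w [sw le_vw ->]] := IHyz v sv (esym ev).
  by exists w; split=> // i; apply: leq_trans (le_vw i).
Qed.

Lemma staircase0 m : staircase m (fun=> 0%N).
Proof. by []. Qed.

Lemma fired0 m : fired m (fun=> 0%N) = initial_config m.
Proof. by apply: funext => i; rewrite /fired muln0 subn0 !addn0. Qed.

Lemma reachable_fired_leP m u v : (0 < m)%N -> staircase m u ->
  staircase m v ->
  reachable (fired m u) (fired m v) <-> (forall i, (u i <= v i)%N).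
Proof.
move=> m_gt0 su sv; split; last exact: reachable_fired_le.
by move=> /reachable_fired-/(_ m_gt0 su)[w [sw le_uw /fired_inj->]].
Qed.

Theorem lemma3p4 (m : nat) (hm : (1 <= m)%N) :
  is_distr_lattice (@config_le (initial_config m)).
Proof.
have reach (x : {u | staircase m u}) :
    reachable (initial_config m) (fired m (sval x)).
  rewrite -fired0; apply: reachable_fired_le => //; exact: proj2_sig.
pose f x : config_poset (initial_config m) := exist _ _ (reach x).
apply: (is_distr_lattice_iso (f := f)); last first.
- apply: is_distr_lattice_dual.
  exact: (is_distr_lattice_pointwise (D := nat) (@staircase_min m)
            (@staircase_max m)).
- move=> x y; rewrite /config_le /=.
  by rewrite reachable_fired_leP //; exact: proj2_sig.
have /choice[g fK] y : exists x, f x = y.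
  case: y => c rc; have := rc.
  rewrite -{1}fired0 => /(reachable_fired hm (staircase0 m))[v [sv _ ev]].
  by exists (exist _ v sv); apply: sig_eq.
exists g => // x; apply: sig_eq; apply: (@fired_inj m) => //.
1,2: exact: proj2_sig.
exact: (congr1 (fun y => proj1_sig y) (fK (f x))).
Qed.
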